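(* Let $\nu^1,\nu^2$ be real eigenvectors of the matrix $B$ corresponding to the eigenvalues $\lambda_1,\lambda_2$ ($\lambda_1\ne\lambda_2$), respectively. Then the system $\dfrac{dx}{dt}=Ax$ has the first integral $$F\colon x\to\bigl|\nu^1x\bigr|^{h_1}\bigl|\nu^2x\bigr|^{h_2}\quad\text{for all }x\in\mathscr X,\quad\mathscr X\subset{\rm D}(F),$$ where $\mathscr X$ is a domain and $h_1,h_2$ is a real solution of the equation $\lambda_1h_1+\lambda_2h_2=0$ with $|h_1|+|h_2|\ne0$.
   Context: $A$ is a real $n\times n$ matrix, $x\in\mathbb R^n$, and $B=A^T$. For a vector $\nu$, $\nu x=\sum_{i=1}^n\nu_ix_i$. A continuously differentiable function $F$ on a domain $\mathscr X\subset\mathbb R^n$ is an autonomous first integral of $dx/dt=Ax$ if $\sum_{i=1}^n(Ax)_i\,\partial_{x_i}F(x)=0$ on $\mathscr X$. ${\rm D}(F)$ denotes the set where $F$ is defined and continuously differentiable. *)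

(* Defs.v *)
From HB Require Import structures.
From mathcomp Require Export all_boot all_order all_algebra.
From mathcomp Require Export all_classical all_reals all_analysis.
Export Order.TTheory GRing.Theory Num.Theory.
Export numFieldNormedType.Exports.
Set Implicit Arguments.
Unset Strict Implicit.
Unset Printing Implicit Defensive.

Local Open Scope classical_set_scope.
Local Open Scope ring_scope.

(* Eigenvectors are columns acted upon from the left; [eigenspace] of mxalgebra
   uses row vectors ([v *m M = a *: v]) instead. *)
Definition eigenvector (R : realType) (n : nat) (M : 'M[R]_n) (lambda : R)
    (nu : 'cV[R]_n) : Prop :=
  nu != 0 /\ M *m nu = lambda *: nu.

Definition pairing (R : realType) (n : nat) (nu x : 'cV[R]_n) : R :=
  \sum_(i < n) nu i 0 * x i 0.

Definition domain (R : realType) (n : nat) (X : set 'cV[R]_n) : Prop :=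
  [/\ open X, connected X & X !=set0].

Definition partial (R : realType) (n : nat) (F : 'cV[R]_n -> R) (i : 'I_n)
    (x : 'cV[R]_n) : R :=
  'D_(delta_mx i 0) F x.

Definition continuously_differentiable_at (R : realType) (n : nat)
    (F : 'cV[R]_n -> R) (x : 'cV[R]_n) : Prop :=
  (\forall y \near x, forall i : 'I_n, derivable F y (delta_mx i 0)) /\
  (forall i : 'I_n, {for x, continuous (partial F i)}).

(* D(F) for a partial function, given by its domain of definition [dom] and a
   total function [F] whose values outside [dom] are irrelevant. *)
Definition C1_locus (R : realType) (n : nat) (dom : set 'cV[R]_n)
    (F : 'cV[R]_n -> R) : set 'cV[R]_n :=
  [set x | interior dom x /\ continuously_differentiable_at F x].

Definition autonomous_first_integral (R : realType) (n : nat) (A : 'M[R]_n)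
    (F : 'cV[R]_n -> R) (X : set 'cV[R]_n) : Prop :=
  [/\ domain X,
      forall x, X x -> continuously_differentiable_at F x
    & forall x, X x -> \sum_(i < n) (A *m x) i 0 * partial F i x = 0].

Definition abs_power_product (R : realType) (n : nat) (nu1 nu2 : 'cV[R]_n)
    (h1 h2 : R) (x : 'cV[R]_n) : R :=
  `|pairing nu1 x| `^ h1 * `|pairing nu2 x| `^ h2.

(* [|t| `^ h] is meaningful unless [t = 0] and [h < 0]; there the total [powR]
   returns a junk value. [powR] has [0 `^ 0 = 1], so a factor with exponent 0
   is the constant 1. *)
Definition abs_power_product_dom (R : realType) (n : nat)
    (nu1 nu2 : 'cV[R]_n) (h1 h2 : R) : set 'cV[R]_n :=
  [set x | (pairing nu1 x != 0 \/ 0 <= h1) /\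
           (pairing nu2 x != 0 \/ 0 <= h2)].

(* Main.v *)
Require Import Defs.
From mathcomp Require Import ring lra.
Set Implicit Arguments.
Unset Strict Implicit.
Unset Printing Implicit Defensive.
Local Open Scope classical_set_scope.
Local Open Scope ring_scope.

(** Write [p_k] for the linear form [x |-> pairing nu_k x]. Since [nu_k] is an
    eigenvector of [A^T], transposing gives [p_k (A x) = lambda_k p_k x]: along
    the system, [p_k] grows at the rate [lambda_k]. Where neither form
    vanishes, [F = |p_1|^h1 |p_2|^h2] has the logarithmic derivative
    [h1 nu1_i / p_1 + h2 nu2_i / p_2] in the direction of the [i]-th coordinate
    ([partial_abs_power_product]), so that the derivative of [F] along [A x] is
    [(lambda1 h1 + lambda2 h2) F = 0]
    ([lie_derivative_abs_power_product]).

    The set on which [F] is continuously differentiable may also contain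
    points of the hyperplanes [p_k = 0], for instance when the exponents
    exceed 1, and there the logarithmic derivative makes no sense. But the
    partial derivatives of [F] are continuous at such a point, so the
    derivative along [A x] is continuous there too. It vanishes off the two
    hyperplanes, and some line through the point leaves both of them at once;
    letting the point be approached along this line gives the value 0
    ([eq0_continuous_off_hyperplanes]). *)

(** * The pairing *)

Lemma pairingDZr (R : realType) (n : nat) (nu x v : 'cV[R]_n) (t : R) :
  pairing nu (t *: v + x) = t * pairing nu v + pairing nu x.
Proof.
rewrite /pairing mulr_sumr -big_split /=; apply: eq_bigr => i _.
by rewrite !mxE; ring.
Qed.

Lemma pairingDr (R : realType) (n : nat) (nu v w : 'cV[R]_n) :
  pairing nu (v + w) = pairing nu v + pairing nu w.
Proof. by have := pairingDZr nu w v 1; rewrite scale1r mul1r. Qed.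

Lemma pairingNr (R : realType) (n : nat) (nu v : 'cV[R]_n) :
  pairing nu (- v) = - pairing nu v.
Proof.
by rewrite /pairing -sumrN; apply: eq_bigr => i _; rewrite mxE mulrN.
Qed.

Lemma pairingC (R : realType) (n : nat) (v w : 'cV[R]_n) :
  pairing v w = pairing w v.
Proof. by apply: eq_bigr => i _; rewrite mulrC. Qed.

Lemma pairing_delta_mx (R : realType) (n : nat) (nu : 'cV[R]_n) (i : 'I_n) :
  pairing nu (delta_mx i 0) = nu i 0.
Proof.
rewrite /pairing (bigD1 i) //= big1 => [|j ji]; rewrite mxE.
  by rewrite !eqxx mulr1 addr0.
by rewrite (negPf ji) mulr0.
Qed.

Lemma pairing_self_gt0 (R : realType) (n : nat) (nu : 'cV[R]_n) :
  nu != 0 -> 0 < pairing nu nu.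
Proof.
move=> nu0; have [i nui0] : exists i, nu i 0 != 0.
  apply/existsP; apply: contraNT nu0 => /existsPn nu0.
  by apply/eqP/colP => i; apply/eqP; rewrite mxE; apply: contraNT (nu0 i).
rewrite /pairing (bigD1 i) //= ltr_pwDl //.
  by rewrite -expr2 exprn_even_gt0 //= nui0.
by apply: sumr_ge0 => j _; rewrite -expr2 sqr_ge0.
Qed.

Lemma pairing_mulmx (R : realType) (n : nat) (A : 'M[R]_n) (nu x : 'cV[R]_n) :
  pairing nu (A *m x) = pairing (A^T *m nu) x.
Proof.
rewrite /pairing.
under eq_bigr do rewrite mxE mulr_sumr.
rewrite exchange_big /=; apply: eq_bigr => j _.
by rewrite mxE mulr_suml; apply: eq_bigr => i _; rewrite mxE; ring.
Qed.

Lemma pairing_eigenvector (R : realType) (n : nat) (A : 'M[R]_n) (lambda : R)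
    (nu x : 'cV[R]_n) :
  eigenvector A^T lambda nu ->
  pairing nu (A *m x) = lambda * pairing nu x.
Proof.
case=> _ e; rewrite pairing_mulmx e /pairing mulr_sumr.
by apply: eq_bigr => i _; rewrite mxE mulrA.
Qed.

(** The sum of the two vectors works when their pairing is nonnegative, the
    difference otherwise: no cancellation with the positive
    [pairing nu nu] can then occur. *)
Lemma common_nonorthogonal (R : realType) (n : nat) (nu1 nu2 : 'cV[R]_n) :
  nu1 != 0 -> nu2 != 0 ->
  exists v, pairing nu1 v != 0 /\ pairing nu2 v != 0.
Proof.
move=> /pairing_self_gt0 a /pairing_self_gt0 b.
case: (leP 0 (pairing nu1 nu2)) => c.
  by exists (nu1 + nu2); rewrite !pairingDr (pairingC nu2 nu1); split; lra.
exists (nu1 - nu2); rewrite !pairingDr !pairingNr (pairingC nu2 nu1).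
by split; lra.
Qed.

(** * Continuity *)

Lemma cvg_sumr (R : realType) (T I : Type) (F : set_system T) (r : seq I)
    (f : I -> T -> R) (l : I -> R) :
  Filter F -> (forall i, f i x @[x --> F] --> l i) ->
  \sum_(i <- r) f i x @[x --> F] --> \sum_(i <- r) l i.
Proof.
by move=> FF fl; apply: cvg_big => //; exact: add_continuous.
Qed.

Lemma pairing_continuous (R : realType) (n : nat) (nu : 'cV[R]_n) :
  continuous (pairing nu).
Proof.
by move=> x; apply: (@cvg_sumr R _ _ (nbhs x)) => i; apply: cvgMl_tmp;
  exact: coord_continuous.
Qed.

Lemma mulmx_coord_continuous (R : realType) (m n : nat) (A : 'M[R]_(m, n))
    (i : 'I_m) :
  continuous (fun y : 'cV[R]_n => (A *m y) i 0).
Proof.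
have -> : (fun y : 'cV[R]_n => (A *m y) i 0) = pairing (row i A)^T.
  by apply/funext => y; rewrite mxE; apply: eq_bigr => j _; rewrite !mxE.
exact: pairing_continuous.
Qed.

(** * Derivatives off the hyperplanes *)

(** Near [p != 0] the absolute value is the linear map [t |-> sg p * t], so
    that the chain rule applies to the power function on the positive reals.
    The value is written without the exponent [h - 1], so that the power
    itself can be factored out of the derivative of a product of powers. *)
Lemma is_derive_normr_powR (R : realType) (h p : R) : p != 0 ->
  is_derive p 1 (fun t => `|t| `^ h) (h * `|p| `^ h / p).
Proof.
move=> p0.
have np : 0 < `|p| by rewrite normr_gt0.
have cvg_sg : Num.sg p * t @[t --> p] --> Num.sg p * p.
  by apply: cvgMl_tmp; exact: cvg_id.
have sg_normr : \forall t \near p,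
    ((@powR R)^~ h \o *%R (Num.sg p)) t = `|t : R| `^ h.
  have sg_gt0 : \forall t \near p, 0 < Num.sg p * t.
    by apply: (cvgr_gt _ cvg_sg); rewrite -normrEsg.
  near=> t => /=; have st : 0 < Num.sg p * t by near: t.
  by rewrite -(gtr0_norm st) normrM normr_sg p0 mul1r.
apply: near_eq_is_derive sg_normr _.
have D1 : is_derive (Num.sg p * p) 1 ((@powR R)^~ h) (h * `|p| `^ (h - 1)).
  by rewrite -normrEsg; apply: is_derive1_powR.
have D2 : is_derive p 1 ( *%R (Num.sg p)) (Num.sg p).
  have := is_deriveZ (Num.sg p) (is_derive_id p 1).
  by rewrite /GRing.scale /= mulr1.
apply: is_derive_eq (is_derive1_comp D1 D2) _.
have -> : `|p| `^ (h - 1) = `|p| `^ h / `|p|.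
  by rewrite powRB ?powRr1 ?normr_ge0 // normr_eq0 p0 implybT.
rewrite [in RHS](numEsg p) invfM invr_sg normrM normr_sg p0 normr_id mul1r.
by ring.
Unshelve. all: end_near.
Qed.

(** By linearity of the pairing, the difference quotient of the composite at [x]
    in the direction [v] is that of [f] at [pairing nu x] in the direction
    [pairing nu v]. *)
Lemma is_derive_comp_pairing (R : realType) (n : nat) (nu x v : 'cV[R]_n)
    (f : R -> R) (d : R) :
  is_derive (pairing nu x) 1 f d ->
  is_derive x v (f \o pairing nu) (pairing nu v * d).
Proof.
case=> fd <-.
have Df : differentiable f (pairing nu x) by apply/derivable1_diffP.
have Dv : is_derive (pairing nu x) (pairing nu v) f
    (pairing nu v * 'D_1 f (pairing nu x)).
  split; first exact: diff_derivable.
  rewrite !deriveE // -[X in 'd f _ X = _]mulr1.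
  exact: linearZ.
have E : (fun t => t^-1 *: (((f \o pairing nu) \o shift x) (t *: v) -
                            (f \o pairing nu) x)) =
    (fun t => t^-1 *: ((f \o shift (pairing nu x)) (t *: pairing nu v) -
                            f (pairing nu x))).
  by apply/funext => t /=; rewrite pairingDZr.
case: Dv => Dv1 Dv2.
by split; rewrite /derivable /derive E.
Qed.

Lemma partial_abs_power_product (R : realType) (n : nat)
    (nu1 nu2 : 'cV[R]_n) (h1 h2 : R) (x : 'cV[R]_n) (i : 'I_n) :
  pairing nu1 x != 0 -> pairing nu2 x != 0 ->
  partial (abs_power_product nu1 nu2 h1 h2) i x =
  abs_power_product nu1 nu2 h1 h2 x *
    (h1 * nu1 i 0 / pairing nu1 x + h2 * nu2 i 0 / pairing nu2 x).
Proof.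
move=> p1 p2.
have D1 := is_derive_comp_pairing (delta_mx i 0) (is_derive_normr_powR h1 p1).
have D2 := is_derive_comp_pairing (delta_mx i 0) (is_derive_normr_powR h2 p2).
have D := is_deriveM D1 D2.
rewrite /partial (@derive_val _ _ _ _ _ _ _ D) /= !pairing_delta_mx.
rewrite /GRing.scale /abs_power_product /=.
by field; rewrite p1 p2.
Qed.

(** Each [pairing nu_k] in the denominator of the logarithmic derivative is
    cancelled by the factor [pairing nu_k (A *m x) = lambda_k * pairing nu_k x].
    *)
Lemma lie_derivative_abs_power_product (R : realType) (n : nat) (A : 'M[R]_n)
    (nu1 nu2 : 'cV[R]_n) (lambda1 lambda2 h1 h2 : R) (x : 'cV[R]_n) :
  eigenvector A^T lambda1 nu1 -> eigenvector A^T lambda2 nu2 ->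
  pairing nu1 x != 0 -> pairing nu2 x != 0 ->
  \sum_(i < n) (A *m x) i 0 * partial (abs_power_product nu1 nu2 h1 h2) i x =
  (lambda1 * h1 + lambda2 * h2) * abs_power_product nu1 nu2 h1 h2 x.
Proof.
move=> e1 e2 p1 p2; set F := abs_power_product _ _ _ _.
transitivity (F x * (h1 / pairing nu1 x * pairing nu1 (A *m x) +
                     h2 / pairing nu2 x * pairing nu2 (A *m x))).
  rewrite /pairing !mulr_sumr -big_split mulr_sumr /= -/(pairing _ _).
  apply: eq_bigr => i _; rewrite partial_abs_power_product // -/F /pairing.
  by ring.
rewrite (pairing_eigenvector _ e1) (pairing_eigenvector _ e2).
by field; rewrite p1 p2.
Qed.

(** * Crossing the hyperplanes *)

(** Along the line through [x] directed by a vector [v] orthogonal to neither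
    [nu1] nor [nu2], both pairings are nonzero except for at most one value
    of the parameter each; hence [G] is 0 on a punctured neighbourhood of [x]
    in this line, and [G x] is its limit. *)
Lemma eq0_continuous_off_hyperplanes (R : realType) (n : nat)
    (nu1 nu2 : 'cV[R]_n) (G : 'cV[R]_n -> R) (x : 'cV[R]_n) :
  nu1 != 0 -> nu2 != 0 -> {for x, continuous G} ->
  (forall y, pairing nu1 y != 0 -> pairing nu2 y != 0 -> G y = 0) ->
  G x = 0.
Proof.
move=> nu10 nu20 Gx G0.
have [v [v1 v2]] := common_nonorthogonal nu10 nu20.
have line : (fun t : R => t *: v + x) @ 0^' --> x.
  have : t *: v + x @[t --> (0 : R)^'] --> 0 *: v + x.
    apply: cvgD; last exact: cvg_cst.
    by apply: cvgZr_tmp; exact: cvg_within.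
  by rewrite scale0r add0r.
have off nu : pairing nu v != 0 ->
    \forall t \near 0^', pairing nu (t *: v + x) != 0.
  move=> nuv; have [nux|nux] := eqVneq (pairing nu x) 0.
    near=> t; rewrite pairingDZr nux addr0 mulf_neq0 //.
    by near: t; exact: nbhs_dnbhs_neq.
  by apply: cvgr_neq0 nux; apply: cvg_comp line _; exact: pairing_continuous.
have Gline : G (t *: v + x) @[t --> 0^'] --> G x by apply: cvg_comp line Gx.
apply: norm_cvg_unique Gline _.
apply: cvg_near_cst; near=> t; apply: G0; near: t; exact: off.
Unshelve. all: end_near.
Qed.

Theorem theorem3p2 (R : realType) (n : nat) (A : 'M[R]_n)
    (nu1 nu2 : 'cV[R]_n) (lambda1 lambda2 : R) (h1 h2 : R)
    (X : set 'cV[R]_n) :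
  eigenvector A^T lambda1 nu1 ->
  eigenvector A^T lambda2 nu2 ->
  lambda1 != lambda2 ->
  lambda1 * h1 + lambda2 * h2 = 0 ->
  `|h1| + `|h2| != 0 ->
  domain X ->
  X `<=` C1_locus (abs_power_product_dom nu1 nu2 h1 h2)
                  (abs_power_product nu1 nu2 h1 h2) ->
  autonomous_first_integral A (abs_power_product nu1 nu2 h1 h2) X.
Proof.
move=> e1 e2 _ h0 _ domX XC1; split=> // x /XC1[_] // [_ C1x].
set F := abs_power_product _ _ _ _.
apply: (@eq0_continuous_off_hyperplanes _ _ nu1 nu2
  (fun y => \sum_(i < n) (A *m y) i 0 * partial F i y)).
- by case: e1.
- by case: e2.
- apply: (@cvg_sumr R _ _ (nbhs x)) => i; apply: cvgM; last exact: C1x.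
  exact: mulmx_coord_continuous.
- move=> y p1 p2.
  by rewrite (lie_derivative_abs_power_product _ _ e1 e2) // h0 mul0r.
Qed.
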